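(* Let $G$ be a connected graph with root $r$ such that $G$ satisfies the rooted triangle condition. If every daisy graph of $G$ with respect to $r$ is isometric in $G$, then for any $u,v\in V(G)$ there exists a pseudo-median in $G$ of size $0$ or $1$ of the triple $(u,v,r)$.
   Context: Distances are shortest-path distances; $I_G(a,b)=\{x: d(a,x)+d(x,b)=d(a,b)\}$. A subgraph is isometric if it preserves distances. For $X\subseteq V(G)$, the daisy graph $G_r(X)$ of $G$ with respect to $r$ is the subgraph of $G$ induced by $\bigcup_{v\in X} I_G(r,v)$. $G$ satisfies the rooted triangle condition (with respect to $r$) if for any two adjacent vertices $v,w$ with $d(r,v)=d(r,w)\ge 2$ there exists a vertex $x$ adjacent to both $v$ and $w$ with $d(x,r)=d(r,v)-1$. A triple $(x,y,z)$ is a pseudo-median of $(u,v,w)$ if: (1) some shortest $u,v$-path contains $x,y$, some shortest $v,w$-path contains $y,z$, and some shortest $u,w$-path contains $x,z$; (2) $d(x,y)=d(y,z)=d(x,z)$; (3) $d(x,y)$ is minimal subject to (1),(2). Its size is $d(x,y)$. *)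

(* Defs.v *)
(* A graph is a symmetric irreflexive [e : rel V] on an [eqType] V, which need
   not be finite. *)
From mathcomp Require Import all_boot.
From mathcomp Require Import boolp classical_sets.

Set Implicit Arguments.
Unset Strict Implicit.
Unset Printing Implicit Defensive.

Local Open Scope classical_set_scope.

Section Distance.
Variables (T : Type) (e : rel T).

Definition walk_of_length (x y : T) (n : nat) : Prop :=
  exists p : seq T, [/\ path e x p, last x p = y & size p = n].

Definition reachable (x y : T) : Prop := exists n, walk_of_length x y n.

Definition connected_graph : Prop := forall x y, reachable x y.

(* Meaningful only when [reachable x y]; the default value is 0. *)
Definition dist (x y : T) : nat :=
  xget 0 [set n | walk_of_length x y n /\
                  forall m, walk_of_length x y m -> n <= m].

Definition interval (a b : T) : set T :=
  [set x | dist a x + dist x b = dist a b].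

End Distance.

Section Daisy.
Variables (V : eqType) (e : rel V).

Definition induced (S : set V) : rel {x : V | x \in S} :=
  fun x y => e (val x) (val y).

(* The reachability clause excludes the default value of [dist] in a
   disconnected subgraph. *)
Definition isometric (S : set V) : Prop :=
  forall x y : {x : V | x \in S},
    (reachable e (val x) (val y) -> reachable (@induced S) x y) /\
    dist (@induced S) x y = dist e (val x) (val y).

Definition daisy (r : V) (X : set V) : set V :=
  \bigcup_(v in X) interval e r v.

Definition rooted_triangle_condition (r : V) : Prop :=
  forall v w : V, e v w -> dist e r v = dist e r w -> 2 <= dist e r v ->
    exists x : V, [/\ e x v, e x w & dist e x r = dist e r v - 1].

Definition shortest_path (a b : V) (p : seq V) : Prop :=
  [/\ path e a p, last a p = b & size p = dist e a b].

(* The vertex sequence of the path starting at [a] with tail [p] is [a :: p];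
   no order of [x] and [y] along the path is imposed. *)
Definition on_common_shortest_path (a b x y : V) : Prop :=
  exists p : seq V, [/\ shortest_path a b p, x \in a :: p & y \in a :: p].

Definition pseudo_median_candidate (u v w x y z : V) : Prop :=
  [/\ on_common_shortest_path u v x y,
      on_common_shortest_path v w y z,
      on_common_shortest_path u w x z,
      dist e x y = dist e y z & dist e y z = dist e x z].

Definition pseudo_median (u v w x y z : V) : Prop :=
  pseudo_median_candidate u v w x y z /\
  forall x' y' z' : V, pseudo_median_candidate u v w x' y' z' ->
    dist e x y <= dist e x' y'.

End Daisy.

(* Main.v *)
(** The daisy graph of [{u, v}] has vertex set [I(r,u) ∪ I(r,v)]; being
    isometric, it contains a shortest [u,v]-path of [G]. Walking along this path
    from [I(r,u)] to [I(r,v)], one meets either a vertex of both intervals,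
    which is a median of [(u, v, r)], or an edge [xy] with [x] in [I(r,u)] and
    [y] in [I(r,v)]. If [d(r,x)] and [d(r,y)] differ, the end closer to [r] lies
    in both intervals; if they agree, [x] and [y] have a common neighbour [z]
    closer to [r], and [(x, y, z)] satisfies conditions (1) and (2) with size 1.
    A candidate of minimal size is then a pseudo-median of size at most 1. *)
Require Import Defs.
From mathcomp Require Import all_boot.
From mathcomp Require Import boolp classical_sets.
From mathcomp Require Import zify.

Set Implicit Arguments.
Unset Strict Implicit.
Unset Printing Implicit Defensive.

Lemma path_exit_edge (T : eqType) (e : rel T) (A : pred T) (x : T) (p : seq T) :
    path e x p -> A x -> ~~ A (last x p) ->
  exists y z, [/\ y \in x :: p, z \in p, e y z, A y & ~~ A z].
Proof.
move=> xp Ax nAlast; have : has (predC A) p.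
  rewrite has_predC; apply: contra nAlast => Ap.
  by apply: (allP (_ : all A (x :: p))); rewrite ?mem_last //= Ax.
move: xp => /[swap]; case/split_find => z p1 p2 nAz.
rewrite cat_path rcons_path has_predC negbK => Ap1 /andP[/andP[_ ez] _].
exists (last x p1), z; split=> //.
- by rewrite cat_rcons -cat_cons mem_cat mem_last.
- by rewrite mem_cat mem_rcons mem_head.
- by apply: (allP (_ : all A (x :: p1))); rewrite ?mem_last //= Ax.
Qed.

Section Walks.
Variables (T : Type) (e : rel T).
Implicit Types x y z : T.

Lemma walk_of_length_dist x y :
  reachable e x y -> walk_of_length e x y (dist e x y).
Proof.
move=> [n xyn]; rewrite /dist; case: xgetP => [d _ [] //|no_min].
have exW : exists m, `[< walk_of_length e x y m >] by exists n; apply/asboolP.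
case: (ex_minnP exW) => m /asboolP xym min_m.
by case: (no_min m); split=> // k /asboolP; exact: min_m.
Qed.

Lemma dist_le_walk x y n : walk_of_length e x y n -> dist e x y <= n.
Proof.
by move=> xyn; rewrite /dist; case: xgetP => [m _ [_]|//]; apply.
Qed.

Lemma walk_of_length_cat x y z m n :
    walk_of_length e x y m -> walk_of_length e y z n ->
  walk_of_length e x z (m + n).
Proof.
move=> [p [xp py <-]] [q [yq qz <-]]; exists (p ++ q).
by rewrite cat_path last_cat size_cat xp py.
Qed.

Lemma walk_of_length_rev x y n :
  symmetric e -> walk_of_length e x y n -> walk_of_length e y x n.
Proof.
move=> e_sym [p [xp <- <-]]; exists (rev (belast x p)); split.
- by rewrite rev_path (@eq_path _ _ e).
- by case: p {xp} => //= a p; rewrite rev_cons last_rcons.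
- by rewrite size_rev size_belast.
Qed.

Lemma distxx x : dist e x x = 0.
Proof. by apply/eqP; rewrite -leqn0; apply: dist_le_walk; exists [::]. Qed.

Lemma distC : symmetric e -> forall x y, dist e x y = dist e y x.
Proof.
move=> e_sym x y; suff W : walk_of_length e x y = walk_of_length e y x.
  by rewrite /dist W.
by apply/funext => n; apply/propext; split; exact: walk_of_length_rev.
Qed.

Lemma interval_left x y : interval e x y x.
Proof. by rewrite /interval /= distxx. Qed.

Lemma interval_right x y : interval e x y y.
Proof. by rewrite /interval /= distxx addn0. Qed.

Lemma intervalC : symmetric e -> forall x y, interval e x y = interval e y x.
Proof.
move=> e_sym x y; apply/funext => z; rewrite /interval /=.
by rewrite addnC !(distC e_sym z) (distC e_sym x y).
Qed.

End Walks.

Section Daisies.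
Variables (V : eqType) (e : rel V).
Local Open Scope classical_set_scope.

Lemma reachable_shortest_path a b :
  reachable e a b -> exists p, shortest_path e a b p.
Proof. exact: walk_of_length_dist. Qed.

Lemma isometric_shortest_path (S : set V) a b :
    isometric e S -> a \in S -> b \in S -> reachable e a b ->
  exists2 p, shortest_path e a b p & {subset p <= S}.
Proof.
move=> isoS aS bS ab; pose a' : {x | x \in S} := exist _ a aS.
have [reach distS] := isoS a' (exist _ b bS).
have [p [a'p pb sp]] := walk_of_length_dist (reach ab).
exists (map val p); last by move=> _ /mapP[w _ ->]; exact: valP.
split; last by rewrite size_map sp distS.
- by rewrite -[a]/(val a') path_map.
- by rewrite -[a]/(val a') last_map pb.
Qed.

Lemma pseudo_median_le_candidate u v w x y z :
    pseudo_median_candidate e u v w x y z ->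
  exists x' y' z', pseudo_median e u v w x' y' z' /\ dist e x' y' <= dist e x y.
Proof.
move=> cand.
pose is_size n := `[< exists x' y' z',
  pseudo_median_candidate e u v w x' y' z' /\ dist e x' y' = n >].
have size_cand x' y' z' : pseudo_median_candidate e u v w x' y' z' ->
    is_size (dist e x' y').
  by move=> cand'; apply/asboolP; exists x', y', z'.
have ex_size : exists n, is_size n.
  by exists (dist e x y); exact: size_cand cand.
have [_ /asboolP[x' [y' [z' [cand' <-]]]] min_size] := ex_minnP ex_size.
exists x', y', z'; split; last exact/min_size/(size_cand _ _ _ cand).
by split=> // x'' y'' z'' /size_cand; exact: min_size.
Qed.

End Daisies.

Section ConnectedGraph.
Variables (V : eqType) (e : rel V).
Hypotheses (e_sym : symmetric e) (e_irr : irreflexive e).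
Hypothesis e_conn : connected_graph e.

Local Notation d := (dist e).
Local Notation I := (interval e).

Lemma dist_triangle y x z : d x z <= d x y + d y z.
Proof.
by apply: dist_le_walk; apply: walk_of_length_cat; exact: walk_of_length_dist.
Qed.

Lemma dist_eq0 x y : (d x y == 0) = (x == y).
Proof.
apply/eqP/eqP => [d0|->]; last exact: distxx.
have [p []] := walk_of_length_dist (e_conn x y).
by rewrite d0 => _ <- /size0nil->.
Qed.

Lemma dist_eq1 x y : (d x y == 1) = e x y.
Proof.
apply/eqP/idP => [d1|exy].
  have [p []] := walk_of_length_dist (e_conn x y); rewrite d1.
  by case: p => [|z [|//]] //=; rewrite andbT => exz <-.
apply/eqP; rewrite eqn_leq dist_le_walk; last by exists [:: y]; rewrite /= exy.
by rewrite lt0n dist_eq0; apply: contraTneq exy => ->; rewrite e_irr.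
Qed.

Lemma dist_edge x y : e x y -> d x y = 1.
Proof. by rewrite -dist_eq1 => /eqP. Qed.

Lemma dist_edge_leS r x y : e x y -> d r y <= (d r x).+1.
Proof. by move=> /dist_edge exy; rewrite -addn1 -exy; exact: dist_triangle. Qed.

Lemma interval_trans a b x y : I a b x -> I a x y -> I a b y.
Proof.
rewrite /interval /= => abx axy.
by have := dist_triangle x y b; have := dist_triangle y a b; lia.
Qed.

Lemma interval_edge r x y : e x y -> d r y = (d r x).+1 -> I r y x.
Proof. by move=> /dist_edge exy ry; rewrite /interval /= exy ry addn1. Qed.

Lemma shortest_path_cat a b x p q :
    I a b x -> shortest_path e a x p -> shortest_path e x b q ->
  shortest_path e a b (p ++ q).
Proof.
move=> abx [ap px sp] [xq qb sq].
by split; rewrite ?cat_path ?last_cat ?size_cat ?px ?ap ?sp ?sq.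
Qed.

Lemma interval_on_common_shortest_path a b x y :
  I a b x -> I x b y -> on_common_shortest_path e a b x y.
Proof.
move=> abx xby.
have [p ap] := reachable_shortest_path (e_conn a x).
have [q xq] := reachable_shortest_path (e_conn x y).
have [s ys] := reachable_shortest_path (e_conn y b).
have [_ px _] := ap; have [_ qy _] := xq.
exists (p ++ q ++ s); split.
- exact: shortest_path_cat abx ap (shortest_path_cat xby xq ys).
- by rewrite -cat_cons mem_cat -px mem_last.
- by rewrite catA -cat_cons mem_cat -{1}qy -px -last_cat mem_last.
Qed.

Lemma interval_pseudo_median_candidate u v w x y z :
    on_common_shortest_path e u v x y -> I u w x -> I v w y ->
    I x w z -> I y w z -> d x y = d y z -> d y z = d x z ->
  pseudo_median_candidate e u v w x y z.
Proof. by move=> *; split=> //; exact: interval_on_common_shortest_path. Qed.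

Lemma interval_path_crossing r a b s p :
    path e s p -> I r a s -> I r b (last s p) ->
    {subset p <= (I r a `|` I r b)%classic} ->
  exists x y, [/\ x \in s :: p, y \in s :: p, I r a x, I r b y &
                  x = y \/ e x y /\ d r x = d r y].
Proof.
move=> sp ras rbp pab.
have [/set_mem rap|nrap] := boolP (last s p \in I r a).
  by exists (last s p), (last s p); rewrite mem_last; split=> //; left.
have [x [y [xp yp exy /set_mem rax nray]]] :=
  path_exit_edge sp (mem_set ras) nrap.
have rby : I r b y.
  by case/set_mem: (pab y yp) => // /mem_set ray; case/negP: nray.
have eyx : e y x by rewrite e_sym.
have := dist_edge_leS r exy; have := dist_edge_leS r eyx.
have [closer_x _ le|closer_y le _|eq_xy _ _] := ltngtP (d r x) (d r y).
- exists x, x; split=> //; last by left.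
  by apply: interval_trans rby (interval_edge exy _); lia.
- case/negP: nray; apply: mem_set.
  by apply: interval_trans rax (interval_edge eyx _); lia.
- by exists x, y; split=> //; [rewrite inE yp orbT | right].
Qed.

Lemma isometric_daisy_crossing r u v :
    isometric e (daisy e r [set u; v]%classic) ->
  exists x y, [/\ on_common_shortest_path e u v x y, I r u x, I r v y &
                  x = y \/ e x y /\ d r x = d r y].
Proof.
rewrite /daisy bigcup_setU !bigcup_set1 => iso.
have ruu : I r u u := interval_right e r u.
have rvv : I r v v := interval_right e r v.
have [||p up p_sub] := isometric_shortest_path iso _ _ (e_conn u v).
- by apply: mem_set; left.
- by apply: mem_set; right.
have [path_up last_p _] := up; rewrite -{2}last_p in rvv.
have [x [y [xp yp rux rvy xy]]] := interval_path_crossing path_up ruu rvv p_sub.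
by exists x, y; split=> //; exists p.
Qed.

Lemma rooted_triangle_common_neighbour r x y :
    rooted_triangle_condition e r -> e x y -> d r x = d r y ->
  exists z, [/\ e x z, e y z, I x r z & I y r z].
Proof.
move=> tri exy rxy.
suff [z [exz eyz rzx]] : exists z, [/\ e x z, e y z & d r x = (d r z).+1].
  exists z; split=> //; rewrite (intervalC e_sym); apply: interval_edge => //.
  - by rewrite e_sym.
  - by rewrite e_sym.
  - by rewrite -rxy.
have [rx_ge2|rx_lt2] := leqP 2 (d r x).
  have [z [ezx ezy zr]] := tri x y exy rxy rx_ge2.
  by exists z; rewrite e_sym ezx e_sym ezy (distC e_sym r z); split=> //; lia.
(* Here the rooted triangle condition says nothing; the root itself works. *)
have rx1 : d r x = 1.
  suff : d r x != 0 by lia.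
  rewrite dist_eq0; apply: contraTneq exy => rx.
  by move/esym/eqP: rxy; rewrite -rx distxx dist_eq0 => /eqP<-; rewrite e_irr.
by exists r; rewrite distxx rx1 !(e_sym _ r) -!dist_eq1 -rxy rx1.
Qed.

Lemma exists_candidate_size_le1 r u v :
    rooted_triangle_condition e r ->
    isometric e (daisy e r [set u; v]%classic) ->
  exists x y z, pseudo_median_candidate e u v r x y z /\ d x y <= 1.
Proof.
move=> tri /isometric_daisy_crossing[x [y [uvxy]]].
rewrite !(intervalC e_sym r) => urx vry [xy|[exy rxy]].
  rewrite -xy in uvxy vry; exists x, x, x; rewrite distxx; split=> //.
  by apply: interval_pseudo_median_candidate => //; exact: interval_left.
have [z [exz eyz xrz yrz]] := rooted_triangle_common_neighbour tri exy rxy.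
exists x, y, z; rewrite dist_edge //; split=> //.
by apply: interval_pseudo_median_candidate; rewrite ?dist_edge.
Qed.

End ConnectedGraph.

Theorem theorem2p6 (V : eqType) (e : rel V) (r : V)
    (e_sym : symmetric e) (e_irr : irreflexive e)
    (e_conn : connected_graph e)
    (e_tri : rooted_triangle_condition e r)
    (daisy_iso : forall X : set V, isometric e (daisy e r X)) :
  forall u v : V, exists x y z : V,
    pseudo_median e u v r x y z /\ (dist e x y = 0 \/ dist e x y = 1).
Proof.
move=> u v.
have [x [y [z [cand size_le1]]]] :=
  exists_candidate_size_le1 e_sym e_irr e_conn e_tri
    (daisy_iso [set u; v]%classic).
have [x' [y' [z' [med size_le]]]] := pseudo_median_le_candidate cand.
by exists x', y', z'; split=> //; lia.
Qed.
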